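(* Let $\kappa$ be a regular uncountable cardinal and $\lambda\ge\kappa$ a cardinal with $\mathrm{cf}(\lambda)\ge\kappa$. Then every club of $[\lambda]^{<\kappa}$ contains an unbounded non-stationary subset.
   Context: $[\lambda]^{<\kappa}$ is the set of subsets of $\lambda$ of cardinality $<\kappa$. For a model $\mathcal{M}$ with universe $\lambda$ and countable vocabulary and $a\subseteq\lambda$, $\mathrm{cl}_{\mathcal{M}}(a)$ denotes the closure of $a$ under the functions (including constants) of $\mathcal{M}$. A club of $[\lambda]^{<\kappa}$ is a set of the form $\mathcal{C}_{\mathcal{M}}=\{a\in[\lambda]^{<\kappa}: a=\mathrm{cl}_{\mathcal{M}}(a)\ \wedge\ a\cap\kappa\in\kappa\}$ for some model $\mathcal{M}$ with universe $\lambda$ and countable vocabulary. The club filter $\mathcal{E}_{\lambda,\kappa}$ is the filter on $[\lambda]^{<\kappa}$ generated by the clubs. A set $S\subseteq[\lambda]^{<\kappa}$ is stationary if $[\lambda]^{<\kappa}\setminus S\notin\mathcal{E}_{\lambda,\kappa}$, and non-stationary otherwise (i.e., it is disjoint from some club). A set $S\subseteq[\lambda]^{<\kappa}$ is unbounded if every member of $[\lambda]^{<\kappa}$ is contained in some member of $S$. *)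

(* Defs.v *)
From mathcomp Require Import all_boot all_order.
From mathcomp Require Import all_classical.

Set Implicit Arguments.
Unset Strict Implicit.
Unset Printing Implicit Defensive.

Local Open Scope classical_set_scope.
Local Open Scope card_scope.
Local Open Scope order_scope.

(* The cardinal lambda is represented by a well-ordered type L whose order type
   is an initial ordinal, and every ordinal <= lambda by a down-closed subset
   of L, as for von Neumann ordinals: lambda itself is [set: L], x : L stands
   for the ordinal [seg x], and the inequality of ordinals is inclusion. *)

Definition seg d (L : orderType d) (x : L) : set L := [set y | y < x].

Definition is_ordinal d (L : orderType d) (A : set L) : Prop :=
  forall x, A x -> seg x `<=` A.

Definition is_cardinal d (L : orderType d) (A : set L) : Prop :=
  is_ordinal A /\ forall x, A x -> ~ (seg x #= A).

Definition cofinal_in d (L : orderType d) (A X : set L) : Prop :=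
  X `<=` A /\ forall x, A x -> exists2 y, X y & x <= y.

(* The least ordinal equipotent to a cofinal subset of A; the least element of
   a nonempty family of down-closed subsets of a well-order is its
   intersection. *)
Definition cof d (L : orderType d) (A : set L) : set L :=
  \bigcap_(M in [set M | is_ordinal M /\
                         exists2 X, cofinal_in A X & M #= X]) M.

Definition regular_cardinal d (L : orderType d) (K : set L) : Prop :=
  [/\ is_cardinal K, infinite_set K & cof K = K].

Record vocabulary := Vocabulary {
  funsym : countType;
  funar : funsym -> nat;
  relsym : countType;
  relar : relsym -> nat }.

(* Constants are the function symbols of arity 0. *)
Record model (U : Type) := Model {
  voc : vocabulary;
  fun_interp : forall f : funsym voc, (funar f).-tuple U -> U;
  rel_interp : forall r : relsym voc, (relar r).-tuple U -> Prop }.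

Definition closed_under U (M : model U) (A : set U) : Prop :=
  forall (f : funsym (voc M)) (t : (funar f).-tuple U),
    (forall i, A (tnth t i)) -> A (fun_interp t).

Definition cl U (M : model U) (a : set U) : set U :=
  smallest (closed_under M) a.

Definition small_sets d (L : orderType d) (K : set L) : set (set L) :=
  [set a | a #<= K /\ ~ (a #= K)].

(* As kappa is the set of the smaller ordinals, [a `&` K] belongs to kappa when
   it is [seg x] for some x in K. *)
Definition club_of d (L : orderType d) (K : set L) (M : model L) :
    set (set L) :=
  [set a | [/\ small_sets K a, a = cl M a &
               exists2 x, K x & a `&` K = seg x]].

Definition is_club d (L : orderType d) (K : set L) (C : set (set L)) : Prop :=
  exists M : model L, C = club_of K M.

(* Filters on the set P, not assumed proper. *)
Definition filter_on T (P : set T) (F : set (set T)) : Prop :=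
  [/\ forall X, F X -> X `<=` P,
      F P,
      forall X Y, F X -> F Y -> F (X `&` Y) &
      forall X Y, F X -> X `<=` Y -> Y `<=` P -> F Y].

Definition club_filter d (L : orderType d) (K : set L) : set (set (set L)) :=
  smallest (filter_on (small_sets K)) (is_club K).

Definition stationary d (L : orderType d) (K : set L) (S : set (set L)) : Prop :=
  S `<=` small_sets K /\ ~ club_filter K (small_sets K `\` S).

Definition nonstationary d (L : orderType d) (K : set L) (S : set (set L)) :
    Prop :=
  S `<=` small_sets K /\ ~ stationary K S.

Definition unbounded d (L : orderType d) (K : set L) (S : set (set L)) : Prop :=
  S `<=` small_sets K /\
  forall a, small_sets K a -> exists2 b, S b & a `<=` b.

(* Main.v *)
Require Import Defs.
From mathcomp Require Import all_boot all_order.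
From mathcomp Require Import all_classical.
From mathcomp Require wochoice.

(* Let M be a model defining the given club C.  Attach to every x a proper
   subset G x of lambda such that each small a contained in x extends to some
   b in C with x in b and b contained in G x.  If lambda > kappa, take for G x
   the closure under M of an ordinal y < lambda above kappa and x, which has
   the cardinality of y by Hessenberg's theorem; if lambda = kappa, take a
   single member of C containing x + 1.  Let S be the set of the b in C such
   that b is contained in G x for some x in b.  As cf(lambda) >= kappa, every
   small set is bounded, so S is unbounded.  If f x lies outside G x for every
   x, no member of S is closed under f, so S misses the club of f. *)

Set Implicit Arguments.
Unset Strict Implicit.
Unset Printing Implicit Defensive.

Import Order.TotalTheory Order.POrderTheory.

Local Open Scope classical_set_scope.
Local Open Scope card_scope.

(** * Cardinal comparison: injections and greedy recursion *)

Lemma card_le_inj T U (A : set T) (B : set U) (f : T -> U) :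
  set_fun A B f -> set_inj A f -> A #<= B.
Proof.
move=> fAB f_inj.
have /injfunPex[g] : exists2 f : T -> U, set_fun A B f & set_inj A f by exists f.
exact: inj_card_le g.
Qed.

Lemma card_le_ex_inj T U (A : set T) (B : set U) : [set: U] !=set0 ->
  A #<= B -> exists2 f : T -> U, set_fun A B f & set_inj A f.
Proof.
elim/Ppointed: U => U in B *; first by case=> x; case: (no x).
by move=> _ /pcard_leP/injfunPex.
Qed.

Section Greedy.
Variables (T : Type) (R : T -> T -> Prop).
Hypothesis R_wf : well_founded R.
Hypothesis R_total : forall x y, [\/ R x y, x = y | R y x].

(* The injection sends each [x] to a point of [Z] not taken by its
   predecessors. *)
Lemma greedy_card_le (U : choiceType) (A : set T) (Z : set U) :
  (forall x, A x -> ~ (Z #<= A `&` [set y | R y x])) -> A #<= Z.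
Proof.
move=> noZ.
have [->|/set0P[x0 Ax0]] := eqVneq A set0; first exact: card_ge0.
have [z0 Zz0] : Z !=set0.
  by apply/set0P/eqP => Z0; apply: (noZ x0 Ax0); rewrite Z0; exact: card_ge0.
pose step x (h : forall y, R y x -> U) :=
  xget z0 (fun z => Z z /\ forall y (Ryx : R y x), A y -> h y Ryx <> z).
pose h := Fix R_wf (fun=> U) step.
have hE x : h x = xget z0 (fun z => Z z /\ forall y, R y x -> A y -> h y <> z).
  rewrite {1}/h Fix_eq; first by [].
  move=> y f g fg; congr step.
  apply: functional_extensionality_dep => u.
  exact: functional_extensionality_dep.
have hP x : A x -> Z (h x) /\ forall y, R y x -> A y -> h y <> h x.
  move=> Ax; rewrite (hE x); set P := (fun z => _ /\ _).
  apply: (@xgetPex _ z0 P); apply: contrapT => noz; apply: (noZ x Ax).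
  (* With no point left, the values at the predecessors of [x] would cover [Z]. *)
  apply: (@card_le_trans _ _ _ (h @` (A `&` [set y | R y x])));
    last exact: card_image_le.
  apply: subset_card_le => z Zz; apply: contrapT => hz; apply: noz.
  by exists z; split=> // y Ryx Ay hyz; apply: hz; exists y.
apply: (@card_le_inj _ _ _ _ h) => [x /hP[]//|x y].
rewrite !inE => Ax Ay hxy.
by have [Rxy|//|Ryx] := R_total x y; [case: (hP y Ay) | case: (hP x Ax)];
  move=> _ /(_ _ ltac:(eassumption)) /(_ ltac:(assumption)); rewrite hxy.
Qed.

(** Either the greedy recursion never runs out of points of [Z], or [Z] embeds in the predecessors
    of some point of [A]. *)
Lemma card_le_total (U : choiceType) (A : set T) (Z : set U) :
  A #<= Z \/ Z #<= A.
Proof.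
have [|/existsNP[x /not_implyP[Ax /contrapT ZA]]] :=
  pselect (forall x, A x -> ~ (Z #<= A `&` [set y | R y x])).
  by move/greedy_card_le; left.
by right; apply: card_le_trans ZA _; apply: subset_card_le => y [].
Qed.

End Greedy.

(** * Coding words and trees by elements of an infinite set *)

Section Words.
Variables (A : Type) (p : A * A -> A) (i : nat -> A).
Hypotheses (p_inj : injective p) (i_inj : injective i).

Let letter (x : nat + A) : A :=
  match x with inl n => p (i 0, i n) | inr a => p (i 1, a) end.

Let letter_inj : injective letter.
Proof.
by move=> [n|a] [m|b] /p_inj[] => [/i_inj->|/i_inj//|/i_inj//|->].
Qed.

(** Iterated pairing, with [i 0] and [i 1] as tags telling the empty word from the others, and in
    [letter] the two kinds of letters. *)
Fixpoint word_code (s : seq (nat + A)) : A :=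
  if s is x :: s' then p (i 1, p (letter x, word_code s')) else p (i 0, i 0).

Lemma word_code_inj : injective word_code.
Proof.
by elim=> [|x s IHs] [|y t] //= /p_inj[]; [move/i_inj|move/i_inj|
  move=> /p_inj[/letter_inj-> /IHs->]].
Qed.

End Words.

Lemma card_tree_le T (A : set T) : infinite_set A -> A `*` A #<= A ->
  [set: GenTree.tree A] #<= A.
Proof.
move=> Ainf AA; have /infinite_setN0[a0 Aa0] := Ainf.
have A0 : [set: A] !=set0 by exists (SigSub (mem_set Aa0)).
have /(card_le_ex_inj A0)[i _ i_inj] : [set: nat] #<= [set: A].
  by rewrite (card_le_eqr (card_setT A)) -infiniteP.
have /(card_le_ex_inj A0)[p _ p_inj] : [set: A * A] #<= [set: A].
  rewrite (card_le_eqr (card_setT A)); apply: card_le_trans AA.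
  apply: (@card_le_inj _ _ _ _ (fun u : A * A => (val u.1, val u.2))).
    by move=> u _ /=; split; exact: set_valP.
  by move=> [u1 u2] [v1 v2] _ _ /= [/val_inj-> /val_inj->].
rewrite -(card_le_eqr (card_setT A)).
apply: (@card_le_inj _ _ _ _ (word_code p i \o @GenTree.encode A)) => //.
move=> s t _ _ /= /word_code_inj st; apply: (pcan_inj (@GenTree.codeK A)).
by apply: st => ? ? ?; [apply: p_inj|apply: i_inj]; rewrite ?inE.
Qed.

(** * Closures in a model *)

Section Closure.
Variables (U : Type) (M : model U).

Lemma sub_cl (a : set U) : a `<=` cl M a.
Proof. exact: sub_gen_smallest. Qed.

Lemma cl_min (a b : set U) : closed_under M b -> a `<=` b -> cl M a `<=` b.
Proof. exact: smallest_sub. Qed.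

Lemma closed_cl (a : set U) : closed_under M (cl M a).
Proof.
by move=> f t tcl b Mab; apply: (Mab.1) => i; exact: tcl.
Qed.

Lemma cl_mono (a b : set U) : a `<=` b -> cl M a `<=` cl M b.
Proof.
move=> ab; apply: cl_min; first exact: closed_cl.
by apply: subset_trans ab _; exact: sub_cl.
Qed.

Lemma cl_id (a : set U) : cl M (cl M a) = cl M a.
Proof. by apply: smallest_id; exact: closed_cl. Qed.

(** Value of a term; [u0] is a junk value for labels that code no function and for wrong numbers of
    arguments. *)
Fixpoint tree_eval (a : set U) (u0 : U) (t : GenTree.tree a) : U :=
  match t with
  | GenTree.Leaf x => val x
  | GenTree.Node n ts =>
    if @unpickle (funsym (voc M)) n is Some f then
      if insub (map (tree_eval u0) ts) is Some us then @fun_interp _ M f us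
      else u0
    else u0
  end.

(* Every element of the closure is the value of a term, a finite tree whose
   leaves are in [a] and whose nodes are labelled by codes of functions. *)
Lemma card_cl_le (a : set U) :
  infinite_set a -> a `*` a #<= a -> cl M a #<= a.
Proof.
move=> ainf aa; have /infinite_setN0[u0 _] := ainf.
apply: card_le_trans (card_tree_le ainf aa).
apply: card_le_trans (card_image_le (tree_eval u0) _).
apply: subset_card_le; apply: cl_min => [f t tP|x ax]; last first.
  by exists (GenTree.Leaf (SigSub (mem_set ax))).
pose s i := sval (cid2 (tP i)).
exists (GenTree.Node (pickle f) [seq s i | i <- enum 'I_(funar f)]) => //=.
rewrite pickleK -map_comp.
suff -> : [seq (tree_eval u0 \o s) i | i <- enum 'I_(funar f)] = val t.
  by rewrite valK.
rewrite -[RHS](map_tnth_enum t); apply: eq_map => i /=.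
by rewrite /s; case: cid2.
Qed.

End Closure.

(** Hilbert's hotel: [x] moves to the start of a copy of the integers in [A] minus [x], which is
    shifted by one; all other points stay. *)
Lemma infinite_card_leD1 (T : choiceType) (A : set T) (x : T) :
  infinite_set A -> A #<= A `\ x.
Proof.
move=> Ainf; have Binf : infinite_set (A `\ x) by apply: infinite_setD.
have [b _] := infinite_setN0 Binf.
have [] : exists2 h : nat -> T, set_fun setT (A `\ x) h & set_inj setT h.
  by apply: card_le_ex_inj; [exists b|apply/infiniteP].
move=> h hB h_inj; have {}h_inj : injective h by move=> n m; apply: h_inj; rewrite inE.
pose idx y := xget 0%N [set n | h n = y].
have idxE n : idx (h n) = n.
  by apply: h_inj; apply: (@xgetPex _ 0%N [set k | h k = h n]); exists n.
pose g y := if y == x then h 0%N else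
            if `[< range h y >] then h (idx y).+1 else y.
apply: (@card_le_inj _ _ _ _ g) => [y Ay|y z].
  rewrite /g; case: eqVneq => [_|/eqP yx]; first exact: hB.
  by case: ifP => _; [exact: hB|].
rewrite !inE /g => Ay Az; case: eqVneq => [->|yx]; case: eqVneq => [->//|zx].
- case: asboolP => [_ /h_inj//|nz hz]; by case: nz; exists 0%N.
- case: asboolP => [_ /h_inj//|nz hz]; by case: nz; exists 0%N.
case: asboolP => [[n _ <-]|nz]; case: asboolP => [[m _ <-]|nz'] //.
- by rewrite !idxE => /h_inj[->].
- by rewrite idxE => hz; case: nz'; exists n.+1.
- by rewrite idxE => hz; case: nz; exists m.+1.
Qed.

(** * Ordinals and cardinals in a well-order *)

Section WellOrder.
Variables (d : Order.disp_t) (L : orderType d).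
Hypothesis L_wo : wochoice.well_order (fun x y : L => (x <= y)%O).

Lemma exists_least (A : set L) : A !=set0 ->
  exists2 x, A x & forall y, A y -> (x <= y)%O.
Proof.
case=> x Ax; have [|z [[/asboolP Az zP] _]] := @L_wo (fun x => `[<A x>]).
  by exists x; apply/asboolP.
by exists z => // y Ay; apply: zP; apply/asboolP.
Qed.

Lemma lt_wf : well_founded (fun x y : L => (x < y)%O).
Proof.
move=> x; apply: contrapT => nx.
have [y ny yP] : exists2 y, ~ Acc (fun x y : L => (x < y)%O) y &
    forall z, ~ Acc (fun x y : L => (x < y)%O) z -> (y <= z)%O.
  by apply: (@exists_least [set y | ~ Acc _ y]); exists x.
apply: ny; split=> z zy; apply: contrapT => /yP.
by rewrite leNgt zy.
Qed.

Lemma lt_trichotomy (x y : L) : [\/ (x < y)%O, x = y | (y < x)%O].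
Proof.
by case: (ltgtP x y) => h; [apply: Or31|apply: Or33|apply: Or32].
Qed.

Lemma ordinal_seg (x : L) : is_ordinal (seg x).
Proof. by move=> y yx z zy; exact: lt_trans yx. Qed.

Lemma wo_card_le_total (A Z : set L) : A #<= Z \/ Z #<= A.
Proof. exact: (card_le_total lt_wf lt_trichotomy). Qed.

Lemma ordinal_card_le (A Z : set L) : is_ordinal A ->
  (forall x, A x -> ~ (Z #<= seg x)) -> A #<= Z.
Proof.
move=> Aord noZ; apply: (greedy_card_le lt_wf lt_trichotomy) => x Ax.
by rewrite setIidr; [exact: noZ | exact: Aord].
Qed.

(** Take the least segment in which [Z] embeds; by minimality the greedy recursion injects it into
    [Z]. If there is none, the whole order serves. *)
Lemma card_eq_ordinal (Z : set L) : exists2 M : set L, is_ordinal M & M #= Z.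
Proof.
have [[x0 Zx0]|noZ] := pselect (exists x : L, Z #<= seg x).
  have [x Zx xP] : exists2 x : L, Z #<= seg x &
      forall y : L, Z #<= seg y -> (x <= y)%O.
    by apply: (@exists_least [set x : L | Z #<= seg x]); exists x0.
  exists (seg x); first exact: ordinal_seg.
  rewrite card_eq_le Zx andbT; apply: ordinal_card_le; first exact: ordinal_seg.
  by move=> y yx /xP; rewrite leNgt yx.
exists setT => //; rewrite card_eq_le [X in _ && X]subset_card_le // andbT.
by apply: ordinal_card_le => // x _ Zx; apply: noZ; exists x.
Qed.

(** * Hessenberg's theorem *)

(** Were [m] the last point, [A] minus [m], which is as large as [A], would lie in [seg m]. *)
Lemma ordinal_limit (A : set L) : is_ordinal A -> infinite_set A ->
  (forall m, A m -> ~ (A #<= seg m)) ->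
  forall m, A m -> exists2 m', A m' & (m < m')%O.
Proof.
move=> Aord Ainf Acard m Am; apply: contrapT => nom; apply: (Acard m Am).
apply: card_le_trans (infinite_card_leD1 m Ainf) _; apply: subset_card_le.
move=> y [Ay /eqP ym]; rewrite /seg /= ltNge; apply/negP => my.
by apply: nom; exists y => //; rewrite lt_neqAle eq_sym ym.
Qed.

(* [A `*` A] is well-ordered by the maximum of the two coordinates first, so
   that its proper initial segments lie in squares of proper initial segments
   of [A]. *)
Lemma square_initial_ordinal (A : set L) :
  is_ordinal A -> infinite_set A ->
  (forall m, A m -> ~ (A #<= seg m)) ->
  (forall m, A m -> infinite_set (seg m) -> seg m `*` seg m #<= seg m) ->
  A `*` A #<= A.
Proof.
move=> Aord Ainf Acard IH.
pose mx (u : L * L) := Order.max u.1 u.2.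
pose R (u v : L * L) := (mx u < mx v)%O \/ mx u = mx v /\
  ((u.1 < v.1)%O \/ u.1 = v.1 /\ (u.2 < v.2)%O).
have Rwf : well_founded R.
  (* Nested inductions on the maximum, the first and the second coordinate. *)
  suff H m : forall a b u, mx u = m -> u.1 = a -> u.2 = b -> Acc R u.
    by move=> u; exact: H.
  elim/(well_founded_ind lt_wf): m => m IHm a.
  elim/(well_founded_ind lt_wf): a => a IHa b.
  elim/(well_founded_ind lt_wf): b => b IHb u um ua ub.
  split=> v [vu|[vu [va|[va vb]]]].
  - by apply: (IHm (mx v)) => //; rewrite -um.
  - by apply: (IHa v.1 _ v.2); rewrite -?ua -?um.
  - by apply: (IHb v.2); rewrite -?ub -?um -?ua.
have Rtot u v : [\/ R u v, u = v | R v u].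
  have [h|h|h] := lt_trichotomy (mx u) (mx v);
    [by apply: Or31; left| |by apply: Or33; left].
  have [h1|h1|h1] := lt_trichotomy u.1 v.1;
    [by apply: Or31; right; split=> //; left| |
     by apply: Or33; right; split=> //; left].
  have [h2|h2|h2] := lt_trichotomy u.2 v.2;
    [by apply: Or31; right; split=> //; right| |
     by apply: Or33; right; split=> //; right].
  by apply: Or32; case: u v h h1 h2 => ? ? [? ?] /= _ -> ->.
apply: (greedy_card_le Rwf Rtot) => u [Au1 Au2] Aseg.
have [m Am um] : exists2 m, A m & (mx u < m)%O.
  by apply: ordinal_limit => //; rewrite /mx maxElt; case: ifP.
have {}Aseg : A #<= seg m `*` seg m.
  apply: card_le_trans Aseg _; apply: subset_card_le => v [_ vu].
  have vm : (mx v < m)%O.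
    by apply: le_lt_trans um; case: vu => [/ltW//|[->]].
  by move: vm; rewrite /mx gt_max => /andP[].
have minf : infinite_set (seg m).
  by move=> mfin; apply: Ainf; apply: card_le_finite Aseg _; exact: finite_setX.
by apply: (Acard m Am); apply: card_le_trans Aseg _; exact: IH.
Qed.

Lemma card_le_square (A B : set L) : A #= B -> B `*` B #<= B -> A `*` A #<= A.
Proof.
move=> AB BB; rewrite (card_le_eqr AB); apply: card_le_trans BB.
have [->|/set0P[x Ax]] := eqVneq A set0; first by rewrite set0X; exact: card_ge0.
have [] : exists2 f : L -> L, set_fun A B f & set_inj A f.
  by apply: card_le_ex_inj; [exists x | move/card_eqPle: AB => []].
move=> f fAB f_inj; apply: (@card_le_inj _ _ _ _ (fun u => (f u.1, f u.2))).
  by move=> u [Au1 Au2]; split; exact: fAB.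
move=> [a b] [a' b']; rewrite !inE => -[/= Aa Ab] [/= Aa' Ab'] [/f_inj fa /f_inj fb].
by congr pair; [apply: fa|apply: fb]; rewrite inE.
Qed.

(** An ordinal that embeds in one of its proper segments inherits the bound from it by induction;
    the others are initial. Arbitrary sets reduce to ordinals. *)
Lemma square_card_le (A : set L) : infinite_set A -> A `*` A #<= A.
Proof.
have squareW (B : set L) : is_ordinal B -> infinite_set B ->
    (forall m, B m -> infinite_set (seg m) -> seg m `*` seg m #<= seg m) ->
    B `*` B #<= B.
  move=> Bord Binf IH.
  have [[m Bm Bsm]|noB] := pselect (exists2 m, B m & B #<= seg m).
    have Beq : B #= seg m by rewrite card_eq_le Bsm subset_card_le //; exact: Bord.
    apply: (card_le_square Beq); apply: IH => //.
    by rewrite -(eq_finite_set Beq).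
  by apply: square_initial_ordinal => // m Bm Bsm; apply: noB; exists m.
have squareS (x : L) : infinite_set (seg x) -> seg x `*` seg x #<= seg x.
  elim/(well_founded_ind lt_wf): x => x IH xinf.
  by apply: squareW => //; exact: ordinal_seg.
move=> Ainf; have [M Mord MA] := card_eq_ordinal A.
have Minf : infinite_set M by rewrite (eq_finite_set MA).
apply: (card_le_square (card_esym MA)); apply: squareW => // m _; exact: squareS.
Qed.

Lemma wo_card_cl_le (M : model L) (a : set L) : infinite_set a -> cl M a #<= a.
Proof. by move=> ainf; apply: card_cl_le => //; exact: square_card_le. Qed.

(** * Cofinality and small sets *)

(** An unbounded [Z] would be cofinal, so the ordinal equipotent to it would contain [cof A], hence
    [K]. *)
Lemma cof_bounded (A K Z : set L) : K `<=` cof A -> Z `<=` A -> ~ (K #<= Z) ->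
  exists2 y, A y & Z `<=` seg y.
Proof.
move=> KA ZA KZ; apply: contrapT => noy.
have Zcof : cofinal_in A Z.
  split=> // x Ax; apply: contrapT => nox; apply: noy; exists x => // z Zz.
  by rewrite /seg /= ltNge; apply/negP => xz; apply: nox; exists z.
have [M Mord MZ] := card_eq_ordinal Z; apply: KZ.
rewrite -(card_le_eqr MZ); apply: subset_card_le => x /KA; apply.
by split=> //; exists Z.
Qed.

Section RegularCardinal.
Variable K : set L.
Hypothesis K_regular : regular_cardinal K.
Hypothesis K_uncountable : ~ countable K.

Lemma small_setsP a : small_sets K a <-> ~ (K #<= a).
Proof.
split=> [[aK na] Ka|Ka]; first by apply: na; rewrite card_eq_le aK.
have [aK|//] := wo_card_le_total a K.
by split=> // /card_eqPle[_ /Ka].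
Qed.

Lemma small_sets_le a b : a #<= b -> small_sets K b -> small_sets K a.
Proof. by move=> ab /small_setsP Kb; apply/small_setsP => /card_le_trans/(_ ab). Qed.

Lemma small_countable (a : set L) : countable a -> small_sets K a.
Proof. by move=> ca; apply/small_setsP => /card_le_trans/(_ ca). Qed.

Lemma small_bounded a : small_sets K a -> a `<=` K ->
  exists2 y, K y & a `<=` seg y.
Proof.
move=> /small_setsP Ka aK; apply: (@cof_bounded K K) => //.
by have [_ _ ->] := K_regular.
Qed.

Lemma small_seg x : K x -> small_sets K (seg x).
Proof.
have [[Kord Kcard] _ _] := K_regular.
move=> Kx; apply/small_setsP => Ksx; apply: (Kcard x Kx).
by rewrite card_eq_le Ksx andbT subset_card_le //; exact: Kord.
Qed.

(* An injection of [K] into [a `|` b] splits [K] into two small, hence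
   bounded, pieces. *)
Lemma small_setU a b : small_sets K a -> small_sets K b -> small_sets K (a `|` b).
Proof.
move=> sa sb; apply/small_setsP => Kab.
have [_ Kinf _] := K_regular; have [k0 _] := infinite_setN0 Kinf.
have [f fK f_inj] : exists2 f : L -> L, set_fun K (a `|` b) f & set_inj K f.
  by apply: card_le_ex_inj Kab; exists k0.
have pre c : small_sets K c -> exists2 y, K y & K `&` f @^-1` c `<=` seg y.
  move=> sc; apply: small_bounded; last by move=> ? [].
  apply: small_sets_le sc; apply: (@card_le_inj _ _ _ _ f) => [x []//|x y].
  by rewrite !inE => -[Kx _] [Ky _]; apply: f_inj; rewrite inE.
have [y Ky ay] := pre a sa; have [z Kz bz] := pre b sb.
have Km : K (Order.max y z) by rewrite maxElt; case: ifP.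
by have [/(conj Km)/ay|/(conj Km)/bz] := fK _ Km;
  rewrite /seg /= gt_max ltxx ?andbF.
Qed.

Lemma small_cl (M : model L) a : small_sets K a -> small_sets K (cl M a).
Proof.
move=> sa; have [_ Kinf _] := K_regular.
(* Since [a] may be finite, a countable [N] is added to reach the infinite case of the closure
   bound. *)
have [N NN NK] : exists2 N : set L, N #= [set: nat] & N `<=` K.
  by apply/card_subP; rewrite -infiniteP.
have Ninf : infinite_set N by rewrite (eq_finite_set NN); exact: infinite_nat.
have sN : small_sets K N by apply: small_countable; have /card_eqPle[] := NN.
apply: small_sets_le (small_setU sa sN).
apply: (@card_le_trans _ _ _ (cl M (a `|` N))).
  by apply: subset_card_le; apply: cl_mono => x; left.
by apply: wo_card_cl_le; apply: sub_infinite_set Ninf => x; right.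
Qed.

(** * Members of a club above a small set *)

(** Catch-up argument: [s n.+1] bounds the part in [K] of the closure of [a] with [s n]. At the
    supremum [y] of the [s n], the closure meets [K] exactly in [seg y]. *)
Lemma ex_club_between (M : model L) a : small_sets K a ->
  exists2 b, club_of K M b & a `<=` b /\ b `<=` cl M (a `|` K).
Proof.
move=> sa; have [[Kord Kcard] Kinf _] := K_regular.
have [k0 Kk0] := infinite_setN0 Kinf.
pose B y := cl M (a `|` seg y).
have sB y : K y -> small_sets K (B y).
  by move=> Ky; apply/small_cl/small_setU => //; exact: small_seg.
have next y : exists z, K y -> K z /\ B y `&` K `<=` seg z.
  have [Ky|nKy] := pselect (K y); last by exists y.
  have [||z Kz Bz] := @small_bounded (B y `&` K); last by exists z.
    by apply: small_sets_le (sB y Ky); apply: subset_card_le => x [].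
  by move=> x [].
have [nxt nxtP] := choice next.
pose s n := iter n nxt k0.
have Ks n : K (s n) by elim: n => //= n IHn; have [] := nxtP _ IHn.
have Bs n : B (s n) `&` K `<=` seg (s n.+1) by have [] := nxtP _ (Ks n).
have s_mono n m : (n <= m)%N -> (s n <= s m)%O.
  move=> nm; rewrite -(subnK nm); elim: (m - n)%N => //= k IHk.
  apply: le_trans IHk _; rewrite leNgt; apply/negP => lt_s.
  (* If [s] dropped, its new value would lie in the closure that it bounds strictly. *)
  have : seg (s (k + n)%N) (s (k + n).+1) by [].
  move=> lt_s'; suff : seg (s (k + n).+1) (s (k + n).+1) by rewrite /seg /= ltxx.
  by apply: Bs; split; [apply: sub_cl; right|exact: Ks].
(* A countable subset of the uncountable regular [K] is bounded in it. *)
have [z Kz sz] : exists2 z, K z & range s `<=` seg z.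
  apply: small_bounded; last by move=> _ [n _ <-]; exact: Ks.
  by apply: small_countable; apply: card_image_le.
have [y sy yP] : exists2 y, (forall n, s n <= y)%O &
    forall u, (forall n, s n <= u)%O -> (y <= u)%O.
  apply: (@exists_least [set y | forall n, (s n <= y)%O]); exists z => n.
  by apply/ltW; apply: sz; exists n.
have Ky : K y.
  have : (y <= z)%O by apply: yP => n; apply/ltW; apply: sz; exists n.
  by rewrite le_eqVlt => /predU1P[->//|]; exact: Kord.
have seg_y u : (u < y)%O -> exists n, (u < s n)%O.
  move=> uy; apply: contrapT => nou.
  suff : (y <= u)%O by rewrite leNgt uy.
  by apply: yP => n; rewrite leNgt; apply/negP => us; apply: nou; exists n.
(* The increasing union of the closures [B (s n)] is closed because functions
   are finitary. *)
have By : B y `<=` \bigcup_n B (s n).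
  apply: cl_min => [f t tB|u [au|/seg_y[n us]]].
  - pose r i := sval (cid2 (tB i)).
    have rP i : B (s (r i)) (tnth t i) by rewrite /r; case: cid2.
    exists (\max_i r i) => //; apply: closed_cl => i.
    apply: cl_mono (rP i); apply: setUS => v vs.
    by apply: lt_le_trans vs _; apply: s_mono; exact: leq_bigmax.
  - by exists 0 => //; apply: sub_cl; left.
  - by exists n => //; apply: sub_cl; right.
exists (B y).
  split; [exact: sB|by rewrite /B cl_id|exists y => //].
  apply/seteqP; split=> u; last first.
    by move=> uy; split; [apply: sub_cl; right|exact: Kord Ky _ uy].
  case=> /By[n _ Bu] Ku; apply: lt_le_trans (sy n.+1).
  exact: Bs.
split; first by move=> u au; apply: sub_cl; left.
by apply: cl_mono; apply: setUS; exact: Kord.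
Qed.

(** * Proper subsets bounding club members *)

Hypothesis L_cardinal : is_cardinal [set: L].
Hypothesis cof_L : K `<=` cof [set: L].

Lemma small_bounded_setT a : small_sets K a -> exists x, a `<=` seg x.
Proof. by move=> /small_setsP /(cof_bounded cof_L)[//|x _ ax]; exists x. Qed.

Lemma ex_proper_bound (M : model L) (x : L) : exists G : set L, ~ (G = setT) /\
  forall a, small_sets K a -> a `<=` seg x ->
    exists2 b, club_of K M b & [/\ a `<=` b, b x & b `<=` G].
Proof.
have [[Kord Kcard] Kinf _] := K_regular.
have s1 u : small_sets K [set u].
  by apply/small_countable/finite_set_countable; exact: finite_set1.
have [KT|[k nKk]] : K = setT \/ exists k, ~ K k.
  have [|/existsNP nA] := pselect (forall x, K x); last by right.
  by move=> KA; left; apply/seteqP; split.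
(* Case kappa = lambda: [seg x] is itself small, so one [b] serves every [a]. *)
- have [|b bC [xb _]] := @ex_club_between M (seg x `|` [set x]).
    by apply: small_setU => //; apply: small_seg; rewrite KT.
  exists b; split.
    by move=> bT; case: bC => /small_setsP; rewrite bT => /(_ (card_leT _)).
  move=> a sa ax; exists b => //; split=> //.
    by move=> u /ax ux; apply: xb; left.
  by apply: xb; right.
(* Case kappa < lambda: [k] lies above all of [K], so [seg y] contains both [K] and [x], and its
   closure is too small to be lambda. *)
- have [y xky] : exists y, [set x] `|` [set k] `<=` seg y.
    by apply/small_bounded_setT/small_setU.
  have ky : (k < y)%O by apply: xky; right.
  have xy : (x < y)%O by apply: xky; left.
  have Ky : K `<=` seg y.
    move=> u Ku; apply: le_lt_trans ky; rewrite leNgt; apply/negP => ku.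
    by apply: nKk; exact: Kord Ku _ ku.
  exists (cl M (seg y)); split.
    move=> clT; have [_ /(_ y I)] := L_cardinal; apply.
    rewrite card_eq_le card_leT -clT; apply: wo_card_cl_le.
    by apply: sub_infinite_set Kinf.
  move=> a sa ax; have [|b bC [ab bM]] := @ex_club_between M (a `|` [set x]).
    exact: small_setU.
  exists b => //; split; [by move=> u au; apply: ab; left|by apply: ab; right|].
  apply: subset_trans bM _; apply: cl_mono => u [[/ax ux|->//]|/Ky//].
  exact: lt_trans xy.
Qed.

End RegularCardinal.
End WellOrder.

(** * Non-stationarity and the conclusion *)

Definition unary_model U (f : U -> U) : model U :=
  @Model U (@Vocabulary unit (fun=> 1%N) unit (fun=> 0%N))
    (fun _ (t : 1.-tuple U) => f (thead t)) (fun _ _ => False).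

Lemma closed_unary U (f : U -> U) (a : set U) (x : U) :
  closed_under (unary_model f) a -> a x -> a (f x).
Proof. by move=> fa ax; apply: (fa tt [tuple x]) => i; rewrite (ord1 i). Qed.

(** Every filter containing the clubs contains that of [M], hence the larger complement of [S]; so
    does the least such filter. *)
Lemma nonstationary_of_club d (L : orderType d) (K : set L) (M : model L)
    (S : set (set L)) :
  S `<=` small_sets K -> S `&` club_of K M = set0 -> nonstationary K S.
Proof.
move=> SK SM; split=> // -[_]; apply => F [[FP _ _ Fup] Fclub].
apply: (Fup (club_of K M)); [by apply: Fclub; exists M| |by move=> a []].
move=> a aM; split; first by case: aM.
by move=> Sa; rewrite -[False]/(set0 a) -SM.
Qed.

Theorem theorem2p1 (d : Order.disp_t) (L : orderType d)
    (L_wo : wochoice.well_order (fun x y : L => (x <= y)%O))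
    (L_cardinal : is_cardinal [set: L])
    (K : set L)
    (K_regular : regular_cardinal K)
    (K_uncountable : ~ countable K)
    (cof_L : K `<=` cof [set: L])
    (C : set (set L)) (C_club : is_club K C) :
  exists S : set (set L),
    [/\ S `<=` C, unbounded K S & nonstationary K S].
Proof.
have [M ->] := C_club.
have [G GP] :=
  choice (ex_proper_bound L_wo K_regular K_uncountable L_cardinal cof_L M).
have /choice[f fG] : forall x, exists y, ~ G x y.
  move=> x; apply/existsNP => GT; case: (GP x) => nGT _; apply: nGT.
  by apply/seteqP; split.
pose S := [set b | club_of K M b /\ exists2 x, b x & b `<=` G x].
have SK : S `<=` small_sets K by move=> b [[]].
exists S; split; first by move=> b [].
  split=> // a sa; have [x ax] := small_bounded_setT L_wo cof_L sa.
  have [_ /(_ a sa ax)[b bC [ab bx bG]]] := GP x.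
  by exists b => //; split=> //; exists x.
apply: (@nonstationary_of_club _ _ _ (unary_model f)) => //.
rewrite -subset0 => b [[_ [x bx bG]] [_ bcl _]].
apply: (fG x); apply: bG; apply: (@closed_unary _ f) bx.
by rewrite bcl; exact: closed_cl.
Qed.
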